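(* For every typing context $\Gamma$, process term $M$, type $A$, and finite map $S : \mathsf{Vars} \rightharpoonup \mathsf{NCfg} \times \mathbb{A}$: if $\Gamma \vdash M :: A$ and $S \in \mathcal{E}[\![\Gamma]\!]$, then $$\mathsf{applyCompl}(S, \hat{\sigma}(M)) \in \mathcal{E}[\![A]\!],$$ where $\sigma = S.2 : \mathsf{Vars} \rightharpoonup \mathbb{A}$ is the substitution obtained by applying the second projection to the values of $S$.
   Context: **Runtime.** $\mathbb{A}$ is a countably infinite set of channel names. A payload is one of $\pi_1$, $\pi_2$, the closing signal $()$, or a channel name. An action is either the silent action $\varepsilon$ or a triple (channel $a$, direction $!$ or $?$, payload $p$), written $a!p$ or $a?p$. For a set $X$, $\mathsf{Atomic}(X)$ consists of the elements $\mathsf{proc}[a](P)$ ($a\in\mathbb{A}$, $P\in X$) and $\mathsf{fwd}[a](b)$ ($a,b\in\mathbb{A}$). $\mathsf{FMSet}(X)$ is the set of finite multisets over $X$, with sum $\uplus$ and unit $\varnothing$. A process language $L$ consists of a set $L.\mathsf{NObj}$ (nameless objects) and a relation $(P,a)\xrightarrow{\alpha}_{L}\Omega'$ with $P\in L.\mathsf{NObj}$, $a\in\mathbb{A}$, $\alpha$ an action, $\Omega'\in\mathsf{FMSet}(\mathsf{Atomic}(L.\mathsf{NObj}))$. Fix a set $\mathsf{ProcLang}$ of process languages; here it is assumed to contain the session-typed language defined below. Put $\mathsf{NObj}=\sum_{L\in\mathsf{ProcLang}}L.\mathsf{NObj}$ (objects of a language are regarded as elements of it by tagging with the language, and likewise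 for multisets of atomic processes), $\mathsf{Obj}=\mathsf{Atomic}(\mathsf{NObj})$, $\mathsf{Cfg}=\mathsf{FMSet}(\mathsf{Obj})$, $\mathsf{NCfg}=\mathsf{Cfg}\times\mathsf{NObj}$. For $N=(\Omega,P)\in\mathsf{NCfg}$ and $a\in\mathbb{A}$, $N[a]=\Omega\uplus\{\mathsf{proc}[a](P)\}$. The labelled transition relation on $\mathsf{Cfg}$ is inductively generated by: - (Obj) if $(P,a)\xrightarrow{\alpha}_{L}\Omega'$ then $\{\mathsf{proc}[a](P)\}\xrightarrow{\alpha}\Omega'$; - (Fwd) $\{\mathsf{proc}[a](P),\mathsf{fwd}[b](a)\}\xrightarrow{\varepsilon}\{\mathsf{proc}[b](P)\}$; - (Frame) if $\Omega\xrightarrow{\alpha}\Omega'$ then $\Omega\uplus\Omega_0\xrightarrow{\alpha}\Omega'\uplus\Omega_0$; - (Comm) if $\Omega_1\xrightarrow{a!c}\Omega_1'$ and $\Omega_2\xrightarrow{a?c}\Omega_2'$ then $\Omega_1\uplus\Omega_2\xrightarrow{\varepsilon}\Omega_1'\uplus\Omega_2'$. $\to^*$ is the reflexive-transitive closure of $\xrightarrow{\varepsilon}$. For $N,N'\in\mathsf{NCfg}$, $N\to^*_{\mathsf{NCfg}}N'$ iff $\forall a\in\mathbb{A}.\ N[a]\to^* N'[a]$. **Types and logical relation.** Types: $A,B::=1\mid A\otimes B\mid A\oplus B\mid A\mathbin{\&}B\mid A\multimap B$. The subsets $\mathcal{E}[\![A]\!],\mathcal{V}[\![A]\!]\subseteq\mathsf{NCfg}$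 are defined by recursion on types (with $a,b$ ranging over $\mathbb{A}$): - $N\in\mathcal{E}[\![A]\!]$ iff $\exists N'.\ N\to^*_{\mathsf{NCfg}}N'$ and $N'\in\mathcal{V}[\![A]\!]$; - $N\in\mathcal{V}[\![1]\!]$ iff $\forall a.\ N[a]\xrightarrow{a!()}\varnothing$; - $N\in\mathcal{V}[\![A\otimes B]\!]$ iff $\exists a\,\forall b\,\exists N_1\in\mathcal{E}[\![A]\!]\,\exists N_2\in\mathcal{E}[\![B]\!].\ N[b]\xrightarrow{b!a}N_1[a]\uplus N_2[b]$; - $N\in\mathcal{V}[\![A\multimap B]\!]$ iff $\forall a\,\forall b\,\forall N_1\in\mathcal{E}[\![A]\!]\,\exists N_2\in\mathcal{E}[\![B]\!].\ N[b]\uplus N_1[a]\xrightarrow{b?a}N_2[b]$; - $N\in\mathcal{V}[\![A\mathbin{\&}B]\!]$ iff $(\forall a\,\exists N_1\in\mathcal{E}[\![A]\!].\ N[a]\xrightarrow{a?\pi_1}N_1[a])$ and $(\forall a\,\exists N_2\in\mathcal{E}[\![B]\!].\ N[a]\xrightarrow{a?\pi_2}N_2[a])$; - $N\in\mathcal{V}[\![A\oplus B]\!]$ iff $(\forall a\,\exists N_1\in\mathcal{E}[\![A]\!].\ N[a]\xrightarrow{a!\pi_1}N_1[a])$ or $(\forall a\,\exists N_2\in\mathcal{E}[\![B]\!].\ N[a]\xrightarrow{a!\pi_2}N_2[a])$. **Process terms.** $\mathsf{Vars}$ is the set of variables. Symbols $s::=a\mid x$ with $a\in\mathbb{A}$,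 $x\in\mathsf{Vars}$. Raw terms (named variables, $i\in\{1,2\}$): $M::=\mathsf{fwd}(\leftarrow s)\mid \mathsf{let}\,x{:}A\leftarrow M_1;M_2\mid \mathsf{send}()\mid \mathsf{recv}_s();M\mid \mathsf{recv}(x\Rightarrow M)\mid \mathsf{send}_s(s');M\mid \mathsf{send}(s);M\mid \mathsf{recv}_s(x\Rightarrow M)\mid \mathsf{recv}(\pi_1\Rightarrow M_1\mid\pi_2\Rightarrow M_2)\mid \mathsf{send}_s(\pi_i);M\mid \mathsf{send}(\pi_i);M\mid \mathsf{recv}_s(\pi_1\Rightarrow M_1\mid\pi_2\Rightarrow M_2)$. **Substitution.** A substitution is a finite map $\sigma:\mathsf{Vars}\rightharpoonup\mathbb{A}$; $\sigma-x$ removes the key $x$; $b/x$ denotes the singleton map $x\mapsto b$. On symbols, $\sigma$ fixes channel names and variables outside its domain. $\hat\sigma(M)$ is defined by structural recursion, replacing every symbol $s$ occurring by $\sigma(s)$, and acting on subterms by $\hat\sigma$, except: in $\mathsf{let}\,x{:}A\leftarrow M_1;M_2$ it acts by $\hat\sigma$ on $M_1$ and $\widehat{\sigma-x}$ on $M_2$; in $\mathsf{recv}_x();M$ with $x$ a variable, the result is $\mathsf{recv}_{\sigma(x)}();\widehat{\sigma-x}(M)$; in $\mathsf{recv}(y\Rightarrow M)$ and $\mathsf{recv}_s(y\Rightarrow M)$ it acts on $M$ by $\widehat{\sigma-y}$. **Typing.** A typing context is a finite map $\Gamma:\mathsf{Vars}\rightharpoonup\mathsf{Types}$. $\Gamma,x{:}A$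 is the extension of $\Gamma$ by $x\mapsto A$, used only when $x\notin\mathrm{dom}(\Gamma)$; $\Gamma_1,\Gamma_2$ is the union of contexts with disjoint domains. $\Gamma\vdash M::A$ is inductively generated by: - Cut: $\Gamma_1\vdash M_1::A$ and $\Gamma_2,x{:}A\vdash M_2::B$ imply $\Gamma_1,\Gamma_2\vdash(\mathsf{let}\,x{:}A\leftarrow M_1;M_2)::B$; - Id: $x{:}A\vdash\mathsf{fwd}(\leftarrow x)::A$; - $1$R: $\vdash\mathsf{send}()::1$ (empty context); $1$L: $\Gamma\vdash M::C$ implies $\Gamma,x{:}1\vdash(\mathsf{recv}_x();M)::C$; - $\multimap$R: $\Gamma,y{:}A\vdash M::B$ implies $\Gamma\vdash\mathsf{recv}(y\Rightarrow M)::A\multimap B$; $\multimap$L: $\Gamma,x{:}B\vdash M::C$ implies $\Gamma,x{:}A\multimap B,y{:}A\vdash(\mathsf{send}_x(y);M)::C$; - $\otimes$R: $\Gamma\vdash M::B$ implies $\Gamma,y{:}A\vdash(\mathsf{send}(y);M)::A\otimes B$; $\otimes$L: $\Gamma,x{:}B,y{:}A\vdash M::C$ implies $\Gamma,x{:}A\otimes B\vdash\mathsf{recv}_x(y\Rightarrow M)::C$; - $\&$R: $\Gamma\vdash M_1::A_1$ and $\Gamma\vdash M_2::A_2$ imply $\Gamma\vdash\mathsf{recv}(\pi_1\Rightarrow M_1\mid\pi_2\Rightarrow M_2)::A_1\mathbin{\&}A_2$; $\&$L: $\Gamma,x{:}A_i\vdash M::C$ implies $\Gamma,x{:}A_1\mathbin{\&}A_2\vdash(\mathsf{send}_x(\pi_i);M)::C$;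 - $\oplus$R: $\Gamma\vdash M::A_i$ implies $\Gamma\vdash(\mathsf{send}(\pi_i);M)::A_1\oplus A_2$; $\oplus$L: $\Gamma,x{:}A\vdash M_1::C$ and $\Gamma,x{:}B\vdash M_2::C$ imply $\Gamma,x{:}A\oplus B\vdash\mathsf{recv}_x(\pi_1\Rightarrow M_1\mid\pi_2\Rightarrow M_2)::C$. **Dynamics (the session-typed process language).** Its nameless objects are the raw terms; its transitions are, for all $a,b,c,b'\in\mathbb{A}$ and $i\in\{1,2\}$ (singleton braces omitted): - $(\mathsf{fwd}(\leftarrow b),a)\xrightarrow{\varepsilon}\mathsf{fwd}[a](b)$; - $(\mathsf{let}\,x{:}A\leftarrow M_1;M_2,\,a)\xrightarrow{\varepsilon}\mathsf{proc}[b'](M_1)\uplus\mathsf{proc}[a](\widehat{b'/x}(M_2))$; - $(\mathsf{send}(),a)\xrightarrow{a!()}\varnothing$; $(\mathsf{recv}_a();M,\,b)\xrightarrow{a?()}\mathsf{proc}[b](M)$; - $(\mathsf{recv}(x\Rightarrow M),b)\xrightarrow{b?a}\mathsf{proc}[b](\widehat{a/x}(M))$; $(\mathsf{send}_b(a);M,\,c)\xrightarrow{b!a}\mathsf{proc}[c](M)$; - $(\mathsf{send}(a);M,\,b)\xrightarrow{b!a}\mathsf{proc}[b](M)$; $(\mathsf{recv}_b(x\Rightarrow M),c)\xrightarrow{b?a}\mathsf{proc}[c](\widehat{a/x}(M))$; - $(\mathsf{recv}(\pi_1\Rightarrow M_1\mid\pi_2\Rightarrow M_2),a)\xrightarrow{a?\pi_i}\mathsf{proc}[a](M_i)$;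 $(\mathsf{send}_a(\pi_i);M,\,b)\xrightarrow{a!\pi_i}\mathsf{proc}[b](M)$; - $(\mathsf{send}(\pi_i);M,\,a)\xrightarrow{a!\pi_i}\mathsf{proc}[a](M)$; $(\mathsf{recv}_a(\pi_1\Rightarrow M_1\mid\pi_2\Rightarrow M_2),b)\xrightarrow{a?\pi_i}\mathsf{proc}[b](M_i)$. **Complementary configurations.** For a context $\Gamma$ and a finite map $S:\mathsf{Vars}\rightharpoonup\mathsf{NCfg}\times\mathbb{A}$, $S\in\mathcal{E}[\![\Gamma]\!]$ means: for every variable $x$, either $S$ and $\Gamma$ are both undefined at $x$, or both are defined at $x$ and, writing $S(x)=(N,a)$, $N\in\mathcal{E}[\![\Gamma(x)]\!]$. For $P\in\mathsf{NObj}$, $\mathsf{applyCompl}(S,P)=(\Omega,P)\in\mathsf{NCfg}$, where $\Omega=\biguplus_{x\in\mathrm{dom}(S)}N_x[a_x]$ with $S(x)=(N_x,a_x)$. *)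

(* Defs.v *)
From mathcomp Require Import all_boot.
From mathcomp Require Import finmap multiset.
From mathcomp Require Import boolp classical_sets functions cardinality.
From Stdlib Require Import Relation_Operators.

Set Implicit Arguments.
Unset Strict Implicit.
Unset Printing Implicit Defensive.

Local Open Scope fset_scope.
Local Open Scope fmap_scope.
Local Open Scope mset_scope.

(* {mset _} needs a choiceType; {classic X} equips an arbitrary X with
   the (classical) choiceType structure and is convertible to X. *)
Definition FMSet (X : Type) : Type := {mset {classic X}}.

Definition fms0 {X : Type} : FMSet X := @mset0 {classic X}.
Definition fms1 {X : Type} (x : X) : FMSet X := msetn 1 (x : {classic X}).
Definition fmsD {X : Type} (U V : FMSet X) : FMSet X :=
  @msetD {classic X} U V.
Definition fmsMap {X Y : Type} (f : X -> Y) (U : FMSet X) : FMSet Y :=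
  @seq_mset {classic Y} (map f (@enum_mset {classic X} U)).

Declare Scope cfg_scope.
Delimit Scope cfg_scope with cfg.
Infix "⊎" := fmsD (at level 50, left associativity) : cfg_scope.
Local Open Scope cfg_scope.

Variant side : Type := pi1 | pi2.
Variant dir : Type := Snd | Rcv.

Variant payload (chan : Type) : Type :=
  | PSide of side
  | PClose
  | PChan of chan.
Arguments PSide {chan}.
Arguments PClose {chan}.

Variant action (chan : Type) : Type :=
  | Silent
  | Act of chan & dir & payload chan.
Arguments Silent {chan}.

Variant Atomic (chan X : Type) : Type :=
  | proc of chan & X
  | fwd of chan & chan.
Arguments fwd {chan X}.

Definition atomic_map (chan X Y : Type) (f : X -> Y) (o : Atomic chan X) :
    Atomic chan Y :=
  match o with
  | proc a P => proc a (f P)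
  | fwd a b => fwd a b
  end.

Record ProcLanguage (chan : Type) : Type := MkProcLanguage {
  nobj : Type;
  lstep : nobj -> chan -> action chan -> FMSet (Atomic chan nobj) -> Prop
}.
Arguments lstep {chan} _ _ _ _ _.

Section Runtime.
Context {chan : Type}.

(* A set coerces to the type of its members, so the index type [PL] is
   the type of the languages in PL. *)
Definition NObj (PL : set (ProcLanguage chan)) : Type :=
  {L : PL & nobj (val L)}.

Definition tagObj (PL : set (ProcLanguage chan)) (L : ProcLanguage chan)
    (hL : L \in PL) (P : nobj L) : NObj PL :=
  existT (fun L : PL => nobj (val L)) (exist _ L hL) P.

Context {PL : set (ProcLanguage chan)}.

Definition Obj : Type := Atomic chan (NObj PL).
Definition Cfg : Type := FMSet Obj.
Definition NCfg : Type := (Cfg * NObj PL)%type.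

Definition tagCfg (L : ProcLanguage chan) (hL : L \in PL)
    (U : FMSet (Atomic chan (nobj L))) : Cfg :=
  fmsMap (atomic_map (tagObj hL)) U.

Definition plug (N : NCfg) (a : chan) : Cfg := N.1 ⊎ fms1 (proc a N.2).

Inductive step : Cfg -> action chan -> Cfg -> Prop :=
  | step_obj (L : ProcLanguage chan) (hL : L \in PL) (P : nobj L)
      (a : chan) (l : action chan) (U : FMSet (Atomic chan (nobj L))) :
      lstep L P a l U -> step (fms1 (proc a (tagObj hL P))) l (tagCfg hL U)
  | step_fwd (a b : chan) (P : NObj PL) :
      step (fms1 (proc a P) ⊎ fms1 (fwd b a)) Silent (fms1 (proc b P))
  | step_frame (U U' U0 : Cfg) (l : action chan) :
      step U l U' -> step (U ⊎ U0) l (U' ⊎ U0)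
  | step_comm (U1 U1' U2 U2' : Cfg) (a : chan) (c : payload chan) :
      step U1 (Act a Snd c) U1' -> step U2 (Act a Rcv c) U2' ->
      step (U1 ⊎ U2) Silent (U1' ⊎ U2').

Definition steps : Cfg -> Cfg -> Prop :=
  clos_refl_trans Cfg (fun U U' => step U Silent U').

Definition nsteps (N N' : NCfg) : Prop :=
  forall a : chan, steps (plug N a) (plug N' a).

End Runtime.
Arguments Obj {chan} PL.
Arguments Cfg {chan} PL.
Arguments NCfg {chan} PL.

Inductive type : Type :=
  | One
  | Tensor of type & type
  | Plus of type & type
  | With of type & type
  | Lolli of type & type.

Definition pick_side (T : Type) (i : side) (x1 x2 : T) : T :=
  match i with pi1 => x1 | pi2 => x2 end.

Section LogicalRelation.
Context {chan : Type} (PL : set (ProcLanguage chan)).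

Definition reducesTo (V : set (NCfg PL)) : set (NCfg PL) :=
  fun N => exists N' : NCfg PL, nsteps N N' /\ V N'.

(* [reducesTo (semV A)] is [semE A], defined right below. *)
Fixpoint semV (A : type) : set (NCfg PL) :=
  match A with
  | One => fun N => forall a, step (plug N a) (Act a Snd PClose) fms0
  | Tensor A B => fun N =>
      exists a, forall b, exists N1 N2 : NCfg PL,
        [/\ reducesTo (semV A) N1, reducesTo (semV B) N2
          & step (plug N b) (Act b Snd (PChan a)) (plug N1 a ⊎ plug N2 b)]
  | Lolli A B => fun N =>
      forall (a b : chan) (N1 : NCfg PL), reducesTo (semV A) N1 ->
      exists N2 : NCfg PL, reducesTo (semV B) N2 /\
        step (plug N b ⊎ plug N1 a) (Act b Rcv (PChan a)) (plug N2 b)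
  | With A B => fun N =>
      (forall a, exists N1 : NCfg PL, reducesTo (semV A) N1 /\
         step (plug N a) (Act a Rcv (PSide pi1)) (plug N1 a)) /\
      (forall a, exists N2 : NCfg PL, reducesTo (semV B) N2 /\
         step (plug N a) (Act a Rcv (PSide pi2)) (plug N2 a))
  | Plus A B => fun N =>
      (forall a, exists N1 : NCfg PL, reducesTo (semV A) N1 /\
         step (plug N a) (Act a Snd (PSide pi1)) (plug N1 a)) \/
      (forall a, exists N2 : NCfg PL, reducesTo (semV B) N2 /\
         step (plug N a) (Act a Snd (PSide pi2)) (plug N2 a))
  end.

Definition semE (A : type) : set (NCfg PL) := reducesTo (semV A).

Definition semCtx (Vars : Type) (G : {fmap {classic Vars} -> type})
    (S : {fmap {classic Vars} -> NCfg PL * chan}) : Prop :=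
  forall x : {classic Vars},
    match S.[? x], G.[? x] with
    | None, None => True
    | Some (N, _), Some A => semE A N
    | _, _ => False
    end.

Definition applyCompl (Vars : Type)
    (S : {fmap {classic Vars} -> NCfg PL * chan}) (P : NObj PL) : NCfg PL :=
  (\big[fmsD/fms0]_(x : domf S) plug (S x).1 (S x).2, P).

End LogicalRelation.

Section Terms.
Context (chan : Type) (Vars : Type).

Variant sym : Type :=
  | SChan of chan
  | SVar of Vars.

(* For each type former, the form without an [L] suffix acts on the channel
   the process itself provides, the form with [L] on the symbol it carries. *)
Inductive term : Type :=
  | Fwd of sym
  | Let of Vars & type & term & term
  | SendClose
  | RecvCloseL of sym & term
  | RecvChan of Vars & term
  | SendChanL of sym & sym & term
  | SendChan of sym & term
  | RecvChanL of sym & Vars & term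
  | RecvSide of term & term
  | SendSideL of sym & side & term
  | SendSide of side & term
  | RecvSideL of sym & term & term.

(* Variables range over an arbitrary type; {classic Vars} appears only where
   finite maps need a choiceType of keys.  (A choiceType [Vars] would put
   terms in too large a universe for [nobj].) *)
Definition drop_key (s : {fmap {classic Vars} -> chan}) (x : Vars) :
    {fmap {classic Vars} -> chan} := s.[~ (x : {classic Vars})].

Definition subst_sym (s : {fmap {classic Vars} -> chan}) (u : sym) : sym :=
  match u with
  | SChan a => SChan a
  | SVar x => match s.[? x] with Some a => SChan a | None => SVar x end
  end.

Fixpoint subst (s : {fmap {classic Vars} -> chan}) (M : term) : term :=
  match M with
  | Fwd u => Fwd (subst_sym s u)
  | Let x A M1 M2 => Let x A (subst s M1) (subst (drop_key s x) M2)
  | SendClose => SendClose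
  | RecvCloseL (SChan a) M => RecvCloseL (SChan a) (subst s M)
  (* waiting on a variable consumes it: x is dropped in the continuation *)
  | RecvCloseL (SVar x) M =>
      RecvCloseL (subst_sym s (SVar x)) (subst (drop_key s x) M)
  | RecvChan y M => RecvChan y (subst (drop_key s y) M)
  | SendChanL u v M => SendChanL (subst_sym s u) (subst_sym s v) (subst s M)
  | SendChan u M => SendChan (subst_sym s u) (subst s M)
  | RecvChanL u y M => RecvChanL (subst_sym s u) y (subst (drop_key s y) M)
  | RecvSide M1 M2 => RecvSide (subst s M1) (subst s M2)
  | SendSideL u i M => SendSideL (subst_sym s u) i (subst s M)
  | SendSide i M => SendSide i (subst s M)
  | RecvSideL u M1 M2 => RecvSideL (subst_sym s u) (subst s M1) (subst s M2)
  end.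

Definition subst1 (x : {classic Vars}) (a : chan) (M : term) : term :=
  subst [fmap].[x <- a] M.

Implicit Types (G : {fmap {classic Vars} -> type}) (A B C : type) 
  (x y : {classic Vars}).

Inductive typed : {fmap {classic Vars} -> type} -> term -> type -> Prop :=
  | T_cut G1 G2 x A B M1 M2 :
      [disjoint domf G1 & domf G2] -> x \notin domf G2 ->
      typed G1 M1 A -> typed G2.[x <- A] M2 B ->
      typed (G1 + G2) (Let x A M1 M2) B
  | T_id x A : typed [fmap].[x <- A] (Fwd (SVar x)) A
  | T_oneR : typed [fmap] SendClose One
  | T_oneL G x C M :
      x \notin domf G ->
      typed G M C -> typed G.[x <- One] (RecvCloseL (SVar x) M) C
  | T_lolliR G y A B M :
      y \notin domf G ->
      typed G.[y <- A] M B -> typed G (RecvChan y M) (Lolli A B)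
  | T_lolliL G x y A B C M :
      x \notin domf G -> y \notin domf G -> x != y ->
      typed G.[x <- B] M C ->
      typed G.[x <- Lolli A B].[y <- A] (SendChanL (SVar x) (SVar y) M) C
  | T_tensorR G y A B M :
      y \notin domf G ->
      typed G M B -> typed G.[y <- A] (SendChan (SVar y) M) (Tensor A B)
  | T_tensorL G x y A B C M :
      x \notin domf G -> y \notin domf G -> x != y ->
      typed G.[x <- B].[y <- A] M C ->
      typed G.[x <- Tensor A B] (RecvChanL (SVar x) y M) C
  | T_withR G A1 A2 M1 M2 :
      typed G M1 A1 -> typed G M2 A2 -> typed G (RecvSide M1 M2) (With A1 A2)
  | T_withL G x (i : side) A1 A2 C M :
      x \notin domf G ->
      typed G.[x <- pick_side i A1 A2] M C ->
      typed G.[x <- With A1 A2] (SendSideL (SVar x) i M) C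
  | T_plusR G (i : side) A1 A2 M :
      typed G M (pick_side i A1 A2) -> typed G (SendSide i M) (Plus A1 A2)
  | T_plusL G x A B C M1 M2 :
      x \notin domf G ->
      typed G.[x <- A] M1 C -> typed G.[x <- B] M2 C ->
      typed G.[x <- Plus A B] (RecvSideL (SVar x) M1 M2) C.

Inductive term_step :
    term -> chan -> action chan -> FMSet (Atomic chan term) -> Prop :=
  | S_fwd a b : term_step (Fwd (SChan b)) a Silent (fms1 (fwd a b))
  (* b' is any channel: no freshness condition *)
  | S_let x A M1 M2 a b' :
      term_step (Let x A M1 M2) a Silent
        (fms1 (proc b' M1) ⊎ fms1 (proc a (subst1 x b' M2)))
  | S_oneR a : term_step SendClose a (Act a Snd PClose) fms0
  | S_oneL M a b :
      term_step (RecvCloseL (SChan a) M) b (Act a Rcv PClose) (fms1 (proc b M))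
  | S_lolliR x M a b :
      term_step (RecvChan x M) b (Act b Rcv (PChan a)) (fms1 (proc b (subst1 x a M)))
  | S_lolliL M a b c :
      term_step (SendChanL (SChan b) (SChan a) M) c (Act b Snd (PChan a))
        (fms1 (proc c M))
  | S_tensorR M a b :
      term_step (SendChan (SChan a) M) b (Act b Snd (PChan a)) (fms1 (proc b M))
  | S_tensorL x M a b c :
      term_step (RecvChanL (SChan b) x M) c (Act b Rcv (PChan a))
        (fms1 (proc c (subst1 x a M)))
  | S_withR M1 M2 (i : side) a :
      term_step (RecvSide M1 M2) a (Act a Rcv (PSide i))
        (fms1 (proc a (pick_side i M1 M2)))
  | S_withL M (i : side) a b :
      term_step (SendSideL (SChan a) i M) b (Act a Snd (PSide i)) (fms1 (proc b M))
  | S_plusR M (i : side) a :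
      term_step (SendSide i M) a (Act a Snd (PSide i)) (fms1 (proc a M))
  | S_plusL M1 M2 (i : side) a b :
      term_step (RecvSideL (SChan a) M1 M2) b (Act a Rcv (PSide i))
        (fms1 (proc b (pick_side i M1 M2))).

Definition sessionLang : ProcLanguage chan := MkProcLanguage term_step.

End Terms.

(* Main.v *)
(* The proof is by induction on the typing derivation. The configuration built
   from the complements [S] holds, for every free variable [x : A] of the term,
   a provider in the semantics of [A]. A right rule emits the action demanded by
   the value interpretation at once. A left rule first runs the provider down to
   a value and then synchronises with it; the provider's residual becomes the
   complement of [x] in the premise. A cut may choose
   any channel, as the relation only asks for some reduction to exist. *)

Require Import Defs.
From mathcomp Require Import all_boot.
From mathcomp Require Import finmap multiset.
From mathcomp Require Import boolp classical_sets functions cardinality.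
From mathcomp Require Import zify.
From HB Require Import structures.
From Stdlib Require Import Relation_Operators.

Set Implicit Arguments.
Unset Strict Implicit.
Unset Printing Implicit Defensive.

Local Open Scope fset_scope.
Local Open Scope fmap_scope.
Local Open Scope cfg_scope.

(** * Finite multisets as a commutative monoid *)

Section Multisets.
Context {X : Type}.
Implicit Types U V W : FMSet X.

Lemma fmsDC U V : U ⊎ V = V ⊎ U.
Proof. exact: msetDC. Qed.

Lemma fmsDA U V W : U ⊎ (V ⊎ W) = U ⊎ V ⊎ W.
Proof. exact: msetDA. Qed.

Lemma fms0D U : fms0 ⊎ U = U.
Proof. exact: mset0D. Qed.

End Multisets.

(** Makes the big-operator lemmas apply to the sums that form complements. *)
HB.instance Definition _ (X : Type) :=
  Monoid.isComLaw.Build (FMSet X) (@fms0 X) (@fmsD X)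
    (@fmsDA X) (@fmsDC X) (@fms0D X).

Lemma fmsD0 {X : Type} (U : FMSet X) : U ⊎ fms0 = U.
Proof. exact: Monoid.mulm1. Qed.

(** Rearrangements of sums become linear equations between multiplicities. *)
Ltac fms_ac := apply/msetP => ?; rewrite /fmsD !msetE2; lia.

Section MultisetMap.
Context {X Y : Type} (f : X -> Y).

(** The enumeration of a sum is only a permutation of the concatenated enumerations, so the two
    sides are compared by counting. *)
Lemma fmsMapD (U V : FMSet X) :
  fmsMap f (U ⊎ V) = fmsMap f U ⊎ fmsMap f V.
Proof.
apply/msetP => y; rewrite /fmsMap /fmsD msetE2 !mset_seqE -count_cat -map_cat.
suff /(@perm_map {classic X} {classic Y} f)/seq.permP -> :
  perm_eq (enum_mset (U ⊎ V)) (enum_mset U ++ enum_mset V) by [].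
by apply/allP => x _ /=; rewrite count_cat !count_mem_mset /fmsD msetE2.
Qed.

Lemma fmsMap1 (x : X) : fmsMap f (fms1 x) = fms1 (f x).
Proof.
apply/msetP => y.
by rewrite /fmsMap /fms1 enum_msetn mset_seqE /= msetnE addn0 eq_sym; case: eqP.
Qed.

Lemma fmsMap0 : fmsMap f fms0 = fms0.
Proof.
by apply/msetP => y; rewrite /fmsMap /fms0 enum_mset0 mset_seqE mset0E.
Qed.

End MultisetMap.

(** * Composition and locality of substitution *)

Section Substitution.
Context {chan Vars : Type}.
Implicit Types (s t : {fmap {classic Vars} -> chan}) (x y : {classic Vars}).
Implicit Types (M : term chan Vars) (G : {fmap {classic Vars} -> type}).

(* Without disjointness this fails at [RecvCloseL (SVar x)]: the inner
   substitution may turn [x] into a channel, and then the outer one no longer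
   drops [x]. *)
Lemma subst_subst s t M :
  [disjoint domf s & domf t] -> subst t (subst s M) = subst (t + s) M.
Proof.
have dropD s' t' y : drop_key (t' + s') y = drop_key t' y + drop_key s' y.
  exact: remf_cat.
have disjD s' t' y : [disjoint domf s' & domf t'] ->
    [disjoint domf (drop_key s' y) & domf (drop_key t' y)].
  move=> /fdisjointP d; apply/fdisjointP => z.
  by rewrite !mem_remf => /andP[_ /d zt]; rewrite (negbTE zt) andbF.
have sD s' t' u : subst_sym t' (subst_sym s' u) = subst_sym (t' + s') u.
  case: u => //= z; rewrite fnd_cat.
  by case: (boolP (z \in domf s')) => zs; [rewrite in_fnd | rewrite not_fnd].
elim: M s t => //=.
- by move=> u s t _; rewrite sD.
- by move=> x A M1 IH1 M2 IH2 s t d; rewrite IH1 ?IH2 ?dropD //; exact: disjD.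
- move=> [a|x] M IH s t d /=; first by rewrite IH.
  have E := sD s t (SVar chan x); rewrite /= in E; rewrite -E dropD.
  case: (boolP (x \in domf s)) => xs.
    (* The outer pass now meets a channel and keeps its key [x]; as [x] lies outside [domf t],
       dropping it changes nothing. *)
    rewrite (in_fnd xs) /= IH.
      rewrite [drop_key t x]remf1_id //.
      by move/fdisjointP: d => /(_ _ xs).
    apply/fdisjointP => z; rewrite mem_remf => /andP[_].
    by move/fdisjointP: d; exact.
  by rewrite not_fnd //= IH //; exact: disjD.
- by move=> x M IH s t d; rewrite IH ?dropD //; exact: disjD.
- by move=> u v M IH s t d; rewrite !sD IH.
- by move=> u M IH s t d; rewrite !sD IH.
- by move=> u x M IH s t d; rewrite sD IH ?dropD //; exact: disjD.
- by move=> M1 IH1 M2 IH2 s t d; rewrite IH1 ?IH2.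
- by move=> u i M IH s t d; rewrite sD IH.
- by move=> i M IH s t d; rewrite IH.
- by move=> u M1 IH1 M2 IH2 s t d; rewrite sD IH1 ?IH2.
Qed.

(** Links the dynamics to the induction hypothesis: instantiating a binder after the channels of the
    complement have been filled in amounts to one simultaneous substitution. *)
Lemma subst1_subst s x a M :
  subst1 x a (subst (drop_key s x) M) = subst s.[x <- a] M.
Proof.
rewrite /subst1 subst_subst; last first.
  apply/fdisjointP => z; rewrite mem_remf !inE => /andP[/negbTE zx _].
  by rewrite zx.
congr subst; apply/fmapP => z; rewrite fnd_cat mem_remf !fnd_set inE.
rewrite fnd_rem1; case: eqP => [->//|_] /=.
by rewrite fnd_fmap0; case: ifP => // /negbT zs; rewrite not_fnd.
Qed.

Definition agree_on G s t := {in domf G, forall x, s.[? x] = t.[? x]}.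

Lemma agree_on_set G x A s t :
  agree_on G.[x <- A] s t <-> s.[? x] = t.[? x] /\ agree_on G s t.
Proof.
split=> [e|[ex e] y]; last first.
  by rewrite dom_setf !inE => /predU1P[->|] //; exact: e.
by split=> [|y yG]; apply: e; rewrite dom_setf !inE ?eqxx ?yG ?orbT.
Qed.

Lemma agree_on_drop G x s t :
  agree_on G s t -> agree_on G (drop_key s x) (drop_key t x).
Proof. by move=> e y yG; rewrite !fnd_rem1 (e _ yG). Qed.

Lemma agree_on_set_drop G x A s t :
  agree_on G s t -> agree_on G.[x <- A] (drop_key s x) (drop_key t x).
Proof.
by move=> e; apply/agree_on_set; rewrite !fnd_rem1 eqxx; split=> //;
  exact: agree_on_drop.
Qed.

(** The free variables of a typed term lie in [domf G], and at binders both substitutions drop the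
    bound key. This allows passing between complements of different contexts. *)
Lemma subst_typed_ext G M A s t :
  typed G M A -> agree_on G s t -> subst s M = subst t M.
Proof.
move=> T; elim: T s t => {G M A} /=.
- move=> G1 G2 x A B M1 M2 _ _ _ IH1 _ IH2 s t e; congr Let.
    by apply: IH1 => y y1; apply: e; rewrite mem_catf y1.
  apply: IH2; apply: agree_on_set_drop => y y2.
  by apply: e; rewrite mem_catf y2 orbT.
- by move=> x A s t /agree_on_set[-> _].
- by [].
- move=> G x C M _ _ IH s t /agree_on_set[-> e]; congr RecvCloseL.
  by apply: IH; exact: agree_on_drop.
- move=> G y A B M _ _ IH s t e; congr RecvChan.
  by apply: IH; exact: agree_on_set_drop.
- move=> G x y A B C M _ _ _ _ IH s t /agree_on_set[ey /agree_on_set[ex e]].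
  by rewrite ex ey; congr SendChanL; apply: IH; exact/agree_on_set.
- move=> G y A B M _ _ IH s t /agree_on_set[-> e].
  by congr SendChan; exact: IH.
- move=> G x y A B C M _ _ _ _ IH s t /agree_on_set[ex e].
  rewrite ex; congr RecvChanL; apply: IH.
  by apply: agree_on_set_drop; exact/agree_on_set.
- by move=> G A1 A2 M1 M2 _ IH1 _ IH2 s t e; rewrite (IH1 _ _ e) (IH2 _ _ e).
- move=> G x i A1 A2 C M _ _ IH s t /agree_on_set[ex e].
  by rewrite ex; congr SendSideL; apply: IH; exact/agree_on_set.
- by move=> G i A1 A2 M _ IH s t e; rewrite (IH _ _ e).
- move=> G x A B C M1 M2 _ _ IH1 _ IH2 s t /agree_on_set[ex e].
  by rewrite ex; congr RecvSideL; [apply: IH1 | apply: IH2]; exact/agree_on_set.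
Qed.

End Substitution.

(** * Complements and their decomposition along the context *)

Section Complements.
Context {chan Vars : Type} {PL : set (ProcLanguage chan)}.
Implicit Types (S : {fmap {classic Vars} -> NCfg PL * chan}).
Implicit Types (G : {fmap {classic Vars} -> type}) (x : {classic Vars}).

Definition chans S : {fmap {classic Vars} -> chan} :=
  [fmap x : domf S => (S x).2].

Definition compl S : Cfg PL :=
  \big[fmsD/fms0]_(x : domf S) plug (S x).1 (S x).2.

Lemma fnd_chans S x : (chans S).[? x] = omap snd S.[? x].
Proof.
case: (boolP (x \in domf S)) => xS; last by rewrite !not_fnd.
by rewrite (in_fnd (f := chans S) xS) in_fnd /= ffunE.
Qed.

Lemma chans_set S x N a : chans S.[x <- (N, a)] = (chans S).[x <- a].
Proof.
apply/fmapP => y; rewrite fnd_chans !fnd_set fnd_chans.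
by case: eqP.
Qed.

(** A total function of the key, so that sums over different domains can be split and compared
    without membership proofs. *)
Let plug_at S x : Cfg PL :=
  if S.[? x] is Some (N, a) then plug N a else fms0.

Let complE S : compl S = \big[fmsD/fms0]_(x <- domf S) plug_at S x.
Proof.
rewrite big_seq_fsetE; apply: eq_bigr => -[x xS] _.
by rewrite /plug_at in_fnd; case: (S.[xS]).
Qed.

Lemma compl0 : compl [fmap] = fms0.
Proof. by rewrite complE big_seq_fset0. Qed.

Lemma compl_set S x N a :
  x \notin domf S -> compl S.[x <- (N, a)] = plug N a ⊎ compl S.
Proof.
move=> xS; rewrite !complE dom_setf big_fsetU1 //.
rewrite {1}/plug_at fnd_set eqxx; congr (_ ⊎ _).
apply: eq_fbigr => y yS _; rewrite /plug_at fnd_set.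
by case: eqP => // yx; rewrite -yx yS in xS.
Qed.

Lemma compl_cat S1 S2 : [disjoint domf S1 & domf S2] ->
  compl (S1 + S2) = compl S1 ⊎ compl S2.
Proof.
move=> /fdisjointP d; rewrite !complE domf_cat.
rewrite (big_fsetID _ (mem (domf S1))) /=; congr (_ ⊎ _).
  apply: eq_fbig => y.
    by rewrite !inE; case: (y \in domf S1); rewrite ?andbF.
  (* The union favours [S2]; disjointness rules out an override on [domf S1]. *)
  rewrite !inE => /andP[_ y1]; rewrite /plug_at fnd_cat.
  by rewrite (negbTE (d _ y1)).
apply: eq_fbig => y; rewrite !inE.
  by case: (boolP (y \in domf S1)) => [/d/negbTE->|_]; rewrite ?andbT.
by case/andP=> /orP[->//|y2] _; rewrite /plug_at fnd_cat y2.
Qed.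

Lemma semCtx_dom G S : semCtx G S -> domf S = domf G.
Proof.
move=> h; apply/fsetP => x; have := h x.
by case: fndP => xS; case: fndP => // xG; case: (S.[xS]).
Qed.

Lemma semCtx0 S : semCtx [fmap] S -> S = [fmap].
Proof. by move=> /semCtx_dom; exact: fmap_nil. Qed.

Lemma semCtx_set G S x A N a :
  semCtx G S -> semE A N -> semCtx G.[x <- A] S.[x <- (N, a)].
Proof. by move=> h hN y; rewrite !fnd_set; case: eqP => // _; exact: h. Qed.

(** Isolates the provider of the variable that a rule acts on; as [x] is fresh for [G], removing its
    entry leaves a complement of [G]. *)
Lemma semCtx_set_inv G S x A : x \notin domf G -> semCtx G.[x <- A] S ->
  exists S' N a,
    [/\ S = S'.[x <- (N, a)], x \notin domf S', semCtx G S' & semE A N].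
Proof.
move=> xG h; have := h x; rewrite fnd_set eqxx.
case E: S.[? x] => [[N a]|] // hN; exists S.[~ x], N, a; split=> //.
- apply/fmapP => y; rewrite fnd_set fnd_rem1.
  by case: eqP => [->|].
- by rewrite mem_remf1 eqxx.
- move=> y; have := h y; rewrite fnd_set fnd_rem1.
  by case: eqP => //= ->; rewrite (not_fnd xG).
Qed.

Lemma semCtx_cat_inv G1 G2 S :
    [disjoint domf G1 & domf G2] -> semCtx (G1 + G2) S ->
  exists S1 S2, [/\ S = S1 + S2, [disjoint domf S1 & domf S2],
    semCtx G1 S1 & semCtx G2 S2].
Proof.
move=> d h; have domS := semCtx_dom h; rewrite domf_cat in domS.
have h1 : semCtx G1 S.[& domf G1].
  move=> x; have := h x; rewrite fnd_restrict fnd_cat.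
  case: (boolP (x \in domf G1)) => x1; last by rewrite (not_fnd x1).
  by have /fdisjointP/(_ _ x1)/negbTE -> := d.
have h2 : semCtx G2 S.[& domf G2].
  move=> x; have := h x; rewrite fnd_restrict fnd_cat.
  by case: (boolP (x \in domf G2)) => x2 //; rewrite (not_fnd x2).
exists S.[& domf G1], S.[& domf G2]; split=> //; last first.
  by rewrite (semCtx_dom h1) (semCtx_dom h2).
apply/fmapP => x; rewrite fnd_cat !fnd_restrict (semCtx_dom h2).
case: (boolP (x \in domf G2)) => // x2.
case: (boolP (x \in domf G1)) => // x1.
have : x \notin domf S by rewrite domS inE negb_or x1.
exact: not_fnd.
Qed.

End Complements.

(** * Reductions of configurations, and the fundamental lemma *)

Section Dynamics.
Context {chan Vars : Type} {PL : set (ProcLanguage chan)}.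
Context {hPL : sessionLang chan Vars \in PL}.
Implicit Types (U V W X : Cfg PL) (N : NCfg PL) (P Q : term chan Vars).

Notation tag := (tagObj hPL).

Lemma step_term P a l b Q :
  term_step P a l (fms1 (proc b Q)) ->
  step (fms1 (proc a (tag P))) l (fms1 (proc b (tag Q))).
Proof.
by move=> h; have := step_obj hPL h; rewrite /tagCfg fmsMap1.
Qed.

Lemma step_frame_plug W P l b Q :
  term_step P b l (fms1 (proc b Q)) ->
  step (plug (W, tag P) b) l (plug (W, tag Q) b).
Proof.
move=> /step_term h; rewrite /plug /= ![W ⊎ _]fmsDC.
exact: step_frame.
Qed.

Lemma steps_frame U V W : steps U V -> steps (U ⊎ W) (V ⊎ W).
Proof.
elim=> [U' V' /step_frame h|U'|U' V' W' _ h1 _ h2].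
- exact/rt_step/h.
- exact: rt_refl.
- exact: rt_trans h1 h2.
Qed.

Lemma nsteps_trans N1 N2 N3 : nsteps N1 N2 -> nsteps N2 N3 -> nsteps N1 N3.
Proof. by move=> h1 h2 a; apply: rt_trans (h1 a) (h2 a). Qed.

(** This is how cut, identity and the left rules conclude: they reduce to a configuration already
    known to be semantically typed. *)
Lemma semE_antireduction A N N' : nsteps N N' -> semE A N' -> semE A N.
Proof.
by move=> h [N2 [h2 v]]; exists N2; split=> //; exact: nsteps_trans h h2.
Qed.

Lemma semV_semE A N : semV A N -> semE A N.
Proof. by move=> v; exists N; split=> // a; exact: rt_refl. Qed.

(** Lets one client lemma cover left rules that send and left rules that receive. *)
Definition dual (d : dir) : dir := if d is Snd then Rcv else Snd.

Lemma step_comm_dual U U' V V' a d p :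
  step U (Act a d p) U' -> step V (Act a (dual d) p) V' ->
  step (U ⊎ V) Silent (U' ⊎ V').
Proof.
case: d => /= h1 h2; first exact: step_comm h1 h2.
by rewrite (fmsDC U) (fmsDC U'); exact: step_comm h2 h1.
Qed.

(* The common content of the left rules. [X] is an auxiliary provider handed
   over by the client; it is empty except for the left rule of [Lolli]. *)
Lemma nsteps_client N N' a d p X V W P Q :
  nsteps N N' ->
  step (plug N' a ⊎ X) (Act a d p) V ->
  (forall c, term_step P c (Act a (dual d) p) (fms1 (proc c Q))) ->
  nsteps (plug N a ⊎ X ⊎ W, tag P) (V ⊎ W, tag Q).
Proof.
move=> hN hX hP c; rewrite /plug /=.
(* The provider first runs to [N'] inside the frame; one communication with the client follows. *)
apply: (@rt_trans _ _ _ (plug N' a ⊎ X ⊎ W ⊎ fms1 (proc c (tag P)))).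
  by do 3!apply: steps_frame; exact: hN.
apply: rt_step.
have -> U Z : U ⊎ W ⊎ Z = U ⊎ Z ⊎ W by move=> *; fms_ac.
rewrite (_ : V ⊎ W ⊎ _ = V ⊎ fms1 (proc c (tag Q)) ⊎ W); last by fms_ac.
by apply/step_frame/(step_comm_dual hX)/step_term/hP.
Qed.

Lemma nsteps_let W x A P1 P2 b :
  nsteps (W, tag (Let x A P1 P2))
    (fms1 (proc b (tag P1)) ⊎ W, tag (subst1 x b P2)).
Proof.
move=> a; apply: rt_step; rewrite /plug /=.
have := step_frame W (step_obj hPL (S_let x A P1 P2 a b)).
rewrite /tagCfg fmsMapD !fmsMap1 => h.
rewrite fmsDC [X in step _ _ X](_ : _ = fms1 (proc b (tag P1)) ⊎
  fms1 (proc a (tag (subst1 x b P2))) ⊎ W) //.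
by fms_ac.
Qed.

(** Two silent steps: the term turns into a [fwd] object, which then moves the provider from [a] to
    the channel of the client. *)
Lemma nsteps_fwd N a : nsteps (plug N a, tag (Fwd (SChan Vars a))) N.
Proof.
move=> b; apply: (@rt_trans _ _ _ (plug N a ⊎ fms1 (fwd b a))).
  apply: rt_step; rewrite /plug /= ![N.1 ⊎ _ ⊎ _]fmsDC.
  have := step_obj hPL (S_fwd Vars b a).
  by rewrite /tagCfg fmsMap1; exact: step_frame.
apply: rt_step; rewrite /plug -fmsDA ![N.1 ⊎ _]fmsDC.
exact/step_frame/step_fwd.
Qed.

(** [c0] is the channel on which every cut spawns its left process. [S] stays general in the
    induction, since the premises are used with other complements. *)
Lemma fundamental (c0 : chan) (G : {fmap {classic Vars} -> type})
    (M : term chan Vars) (A : type)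
    (S : {fmap {classic Vars} -> NCfg PL * chan}) :
  typed G M A -> semCtx G S -> semE A (compl S, tag (subst (chans S) M)).
Proof.
move=> T; elim: T S => {G M A}; cbn [subst subst_sym].
- move=> G1 G2 x A B M1 M2 d x2 T1 IH1 T2 IH2 S.
  move=> /(semCtx_cat_inv d)[S1 [S2 [-> dS h1 h2]]].
  have := IH1 _ h1.
  have -> : subst (chans S1) M1 = subst (chans (S1 + S2)) M1.
    apply: (subst_typed_ext T1) => y; rewrite -(semCtx_dom h1) => y1.
    rewrite !fnd_chans fnd_cat.
    by have /fdisjointP/(_ _ y1)/negbTE -> := dS.
  (* The left premise, with its own complement [S1], becomes the provider of [x] at [c0]. *)
  move=> /(semCtx_set x c0 h2)/IH2.
  apply: semE_antireduction.
  rewrite -(semCtx_dom h2) in x2.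
  rewrite compl_cat // compl_set // chans_set.
  have -> : subst (chans S2).[x <- c0] M2 =
      subst (chans (S1 + S2)).[x <- c0] M2.
    apply: (subst_typed_ext T2); apply/agree_on_set; rewrite !fnd_set eqxx.
    split=> // y; rewrite -(semCtx_dom h2) => y2.
    by rewrite !fnd_set !fnd_chans fnd_cat y2.
  rewrite -subst1_subst /plug /= [_ ⊎ fms1 _]fmsDC -fmsDA.
  exact: nsteps_let.
- move=> x A S.
  have x0 : x \notin domf ([fmap] : {fmap {classic Vars} -> type}).
    by rewrite inE.
  move=> /(semCtx_set_inv x0)[S' [N [a]]].
  move=> [-> xS /semCtx0 S0 hN]; rewrite {}S0 in xS *.
  rewrite compl_set // compl0 fmsD0 chans_set fnd_set eqxx.
  exact: semE_antireduction (@nsteps_fwd _ _) hN.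
- move=> S /semCtx0 ->; rewrite compl0; apply: semV_semE => a /=.
  have := step_obj hPL (S_oneR Vars a).
  by rewrite /tagCfg fmsMap0 /plug fms0D.
- move=> G x C M xG T IH S /(semCtx_set_inv xG)[S' [N [a]]].
  move=> [-> xS hS [N' [hN vN]]].
  apply: semE_antireduction (IH _ hS).
  rewrite chans_set compl_set // fnd_set eqxx.
  (* [x] has no entry in [S'], so dropping it leaves exactly [chans S'], as the induction hypothesis
     needs. *)
  rewrite [drop_key _ _]remf1_set eqxx remf1_id; last exact: xS.
  have st : step (plug N' a ⊎ fms0) (Act a Snd PClose) fms0.
    by rewrite fmsD0; exact: vN.
  have := nsteps_client (compl S') hN st
    (fun c => S_oneL (subst (chans S') M) a c).
  by rewrite fmsD0 fms0D.
- move=> G y A B M yG T IH S hS; apply: semV_semE => a b N1 hN1 /=.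
  (* The received provider [N1] joins the complement as the entry of [y]. *)
  exists (plug N1 a ⊎ compl S, tag (subst (chans S).[y <- a] M)); split.
    have := IH _ (semCtx_set y a hS hN1).
    by rewrite chans_set compl_set // (semCtx_dom hS).
  rewrite -subst1_subst.
  have := step_frame_plug (plug N1 a ⊎ compl S)
    (S_lolliR y (subst (drop_key (chans S) y) M) a b).
  by congr step; rewrite /plug /=; fms_ac.
- move=> G x y A B C M xG yG xy T IH S.
  have yG' : y \notin domf G.[x <- Lolli A B].
    by rewrite dom_setf !inE negb_or eq_sym xy.
  move=> /(semCtx_set_inv yG')[S1 [N1 [b [-> yS1 h1 hN1]]]].
  move: h1 yS1 => /(semCtx_set_inv xG)[S' [N [a [-> xS hS [N' [hN vN]]]]]] yS1.
  (* [N1], the provider of [y], is handed over and absorbed into the residual [N2], which stays at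
     the channel [a] of [x]. *)
  have [N2 [hN2 st]] := vN b a N1 hN1.
  apply: semE_antireduction (IH _ (semCtx_set x a hS hN2)).
  (* The entry of [y] can be forgotten because [y] is not in the context of the premise. *)
  have -> : subst (chans S'.[x <- (N, a)].[y <- (N1, b)]) M =
      subst (chans S'.[x <- (N2, a)]) M.
    apply: (subst_typed_ext T); rewrite !chans_set.
    apply/agree_on_set; rewrite !fnd_set (negbTE xy) eqxx; split=> // z zG.
    by rewrite !fnd_set; case: eqP => // zy; rewrite -zy zG in yG.
  rewrite !compl_set // !chans_set !fnd_set !eqxx (negbTE xy).
  rewrite fmsDA [plug N1 b ⊎ _]fmsDC.
  by apply: (nsteps_client _ hN st) => c; exact: S_lolliL.
- move=> G y A B M yG T IH S.
  move=> /(semCtx_set_inv yG)[S' [N [a [-> yS hS hN]]]].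
  (* The channel sent is the one where the provider of [y] already sits; that provider is the first
     component, and the remaining complement goes with the continuation. *)
  apply: semV_semE; exists a => b.
  exists N, (compl S', tag (subst (chans S') M)); split=> //; first exact: IH.
  rewrite compl_set // chans_set fnd_set eqxx.
  have -> : subst (chans S').[y <- a] M = subst (chans S') M.
    apply: (subst_typed_ext T) => z zG.
    by rewrite fnd_set; case: eqP => // zy; rewrite -zy zG in yG.
  have := step_frame_plug (plug N a ⊎ compl S')
    (S_tensorR (subst (chans S') M) a b).
  by congr step; rewrite /plug /=; fms_ac.
- move=> G x y A B C M xG yG xy T IH S.
  move=> /(semCtx_set_inv xG)[S' [N [b [-> xS hS [N' [hN [a vN]]]]]]].
  (* The provider splits: [N1] at the sent channel [a] will serve [y], and [N2] at [b] continues to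
     serve [x]. *)
  have [N1 [N2 [hN1 hN2 st]]] := vN b.
  have h2 := semCtx_set x b hS hN2.
  have yS : y \notin domf S'.[x <- (N2, b)].
    by rewrite (semCtx_dom h2) dom_setf !inE negb_or eq_sym xy.
  apply: semE_antireduction (IH _ (semCtx_set y a h2 hN1)).
  rewrite !compl_set // !chans_set !fnd_set !eqxx.
  rewrite -[plug N b]fmsD0 fmsDA -subst1_subst.
  rewrite -[plug N' b]fmsD0 in st.
  by apply: (nsteps_client _ hN st) => c; exact: S_tensorL.
- move=> G A1 A2 M1 M2 T1 IH1 T2 IH2 S hS; apply: semV_semE; split=> a.
  + exists (compl S, tag (subst (chans S) M1)); split; first exact: IH1.
    exact: step_frame_plug (S_withR _ _ pi1 _).
  + exists (compl S, tag (subst (chans S) M2)); split; first exact: IH2.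
    exact: step_frame_plug (S_withR _ _ pi2 _).
- move=> G x i A1 A2 C M xG T IH S.
  move=> /(semCtx_set_inv xG)[S' [N [a [-> xS hS [N' [hN [v1 v2]]]]]]].
  have [N1 [hN1 st]] : exists N1, semE (pick_side i A1 A2) N1 /\
      step (plug N' a) (Act a Rcv (PSide i)) (plug N1 a).
    by case: i {T IH}; [exact: v1 | exact: v2].
  apply: semE_antireduction (IH _ (semCtx_set x a hS hN1)).
  rewrite !compl_set // !chans_set fnd_set eqxx -[plug N a]fmsD0.
  rewrite -[plug N' a]fmsD0 in st.
  by apply: (nsteps_client _ hN st) => c; exact: S_withL.
- move=> G i A1 A2 M T IH S hS; apply: semV_semE.
  have st a := step_frame_plug (compl S) (S_plusR (subst (chans S) M) i a).
  by case: i T IH st => T IH st; [left | right] => a;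
    exists (compl S, tag (subst (chans S) M)); split; [exact: IH | exact: st
    | exact: IH | exact: st].
- move=> G x A B C M1 M2 xG T1 IH1 T2 IH2 S.
  move=> /(semCtx_set_inv xG)[S' [N [a [-> xS hS [N' [hN]]]]]].
  rewrite chans_set compl_set // fnd_set eqxx -[plug N a]fmsD0.
  case=> /(_ a)[N1 [hN1]]; rewrite -[plug N' a]fmsD0 => st.
  + apply: semE_antireduction (IH1 _ (semCtx_set x a hS hN1)).
    rewrite compl_set // chans_set.
    by apply: (nsteps_client _ hN st) => c; exact: (S_plusL _ _ pi1).
  + apply: semE_antireduction (IH2 _ (semCtx_set x a hS hN1)).
    rewrite compl_set // chans_set.
    by apply: (nsteps_client _ hN st) => c; exact: (S_plusL _ _ pi2).
Qed.

End Dynamics.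

Theorem theorem22 (chan : Type) (chan_countably_infinite : ([set: chan] #= [set: nat])%card)
    (Vars : Type) (PL : set (ProcLanguage chan))
    (hPL : sessionLang chan Vars \in PL)
    (G : {fmap {classic Vars} -> type}) (M : term chan Vars) (A : type)
    (S : {fmap {classic Vars} -> NCfg PL * chan}) :
  typed G M A ->
  semCtx G S ->
  semE A (applyCompl S
            (tagObj hPL (subst ([fmap x : domf S => (S x).2])%fmap M))).
Proof.
(* The channel used for cuts is a preimage of 0 under the bijection with [nat]. *)
have /card_set_bijP[f [_ _ /(_ 0 I)[c0 _ _]]] := chan_countably_infinite.
by move=> T hS; have := fundamental (hPL := hPL) c0 T hS.
Qed.
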